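(* Let $p$ be a prime, let $m$ be a positive integer with $\gcd(p,m)=1$, let $k$ be a nonnegative integer, and let $n=p^km$ (with $n\geq 2$). Then, in $\mathbb{Z}_p[x]$: (i) if $m=1$ (so $k\ge1$), $\Psi_n(x)\equiv(x^2+4)^{\varphi(p^k)/2}$ (for $p=2$, $k=1$ read as $\Psi_2(x)=x$); (ii) if $m=2$, $\Psi_n(x)\equiv x^{\varphi(p^k)}$; (iii) if $m\geq3$ and $p>2$, then $\Psi_n(x)$ factors as a product of $\varphi(m)/\delta$ distinct irreducible monic polynomials of degree $\delta$, each raised to the power $\varphi(p^k)$, where $\delta$ is defined as follows: with $u$ the multiplicative order of $p$ modulo $2m$, $\delta=u/2$ if ($p\equiv1\pmod4$, $u$ even, $p^{u/2}\equiv-1\pmod{2m}$) or ($p\equiv3\pmod4$, $u\equiv0\pmod4$, $p^{u/2}\equiv-1\pmod{2m}$) or ($p\equiv3\pmod4$, $u\equiv2\pmod4$, $p^{u/2}\equiv m\pm1\pmod{2m}$); $\delta=2u$ if $p\equiv3\pmod4$ and $u$ is odd; and $\delta=u$ otherwise; (iv) if $m\geq3$ and $p=2$, then $\Psi_n(x)$ factors as a product of $\varphi(m)/(2\delta)$ distinct irreducible monic polynomials of degree $\delta$, each raised to the power $2\varphi(2^k)$, where, with $u'$ the multiplicative order of $2$ modulo $m$, $\delta=u'/2$ if $u'$ is even and $2^{u'/2}\equiv-1\pmod m$, and $\delta=u'$ otherwise.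
   Context: The Fibonacci polynomials are defined by $F_1(x)=1$, $F_2(x)=x$, and $F_n(x)=xF_{n-1}(x)+F_{n-2}(x)$ for $n\geq 3$. For $n\geq 2$, the $n$-th fibotomic polynomial $\Psi_n(x)\in\mathbb{Z}[x]$ is the product of the monic irreducible factors of $F_n(x)$ which are not factors of $F_k(x)$ for any $k<n$; also $\Psi_1(x)=1$. For $n\ge2$, $\Psi_n$ is monic of degree $\varphi(n)$, where $\varphi$ is Euler's totient function. $\mathbb{Z}_p$ is the field with $p$ elements, and factorization in $\mathbb{Z}_p[x]$ refers to the reduction of $\Psi_n(x)$ modulo $p$. *)

(* Defs.v *)
From HB Require Import structures.
From mathcomp Require Import all_boot all_order all_algebra.
From Stdlib Require Import ClassicalEpsilon.
Set Implicit Arguments. Unset Strict Implicit. Unset Printing Implicit Defensive.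
Import Order.TTheory GRing.Theory Num.Theory.
Local Open Scope ring_scope.

Fixpoint Fib (n : nat) : {poly int} :=
  match n with
  | 0%N => 0
  | n'.+1 => match n' with
             | 0%N => 1
             | n''.+1 => 'X * Fib n' + Fib n''
             end
  end.

Definition zdvd (q f : {poly int}) : Prop := exists r : {poly int}, f = q * r.

Definition monic_irr (q : {poly int}) : Prop :=
  [/\ q \is monic, (1 < size q)%N &
      forall a b : {poly int}, q = a * b -> a \is a GRing.unit \/ b \is a GRing.unit].

(* P is the product of the (distinct) monic irreducible factors of F_n that
   are not factors of F_k for any 1 <= k < n. *)
Definition is_fibotomic (n : nat) (P : {poly int}) : Prop :=
  [/\ P \is monic,
      (forall q, monic_irr q ->
         (zdvd q P <-> zdvd q (Fib n) /\ forall k, (0 < k < n)%N -> ~ zdvd q (Fib k))) &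
      (forall q, monic_irr q -> ~ zdvd (q * q) P)].

Definition Psi (n : nat) : {poly int} :=
  epsilon (inhabits (0 : {poly int})) (is_fibotomic n).

Definition redp (p : nat) (P : {poly int}) : {poly 'F_p} :=
  map_poly (fun z : int => (z%:~R : 'F_p)) P.

(* multiplicative order of a modulo n (for coprime a, n with n >= 2):
   the least k >= 1 with a^k = 1 (mod n) *)
Definition ordmod (a n : nat) : nat :=
  (find (fun k => (a ^ k.+1 == 1 %[mod n])%N) (iota 0 n)).+1.

Definition delta_odd (p m : nat) : nat :=
  let u := ordmod p (2 * m) in
  let h := (p ^ (u./2) %% (2 * m))%N in
  if [|| [&& p %% 4 == 1, ~~ odd u & h == (2 * m).-1]%N,
         [&& p %% 4 == 3, u %% 4 == 0 & h == (2 * m).-1]%N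
       | [&& p %% 4 == 3, u %% 4 == 2 & (h == m.+1) || (h == m.-1)]%N]
  then u./2
  else if ((p %% 4 == 3) && odd u)%N then (2 * u)%N else u.

Definition delta_two (m : nat) : nat :=
  let u := ordmod 2 m in
  if ~~ odd u && (2 ^ (u./2) %% m == m.-1)%N then u./2 else u.

(* Main.v *)
Require Import Defs.
From HB Require Import structures.
From mathcomp Require Import all_boot all_order all_algebra.
From mathcomp Require Import all_field cyclic zify ring.
From Stdlib Require Import Classical ClassicalEpsilon.
Set Implicit Arguments. Unset Strict Implicit. Unset Printing Implicit Defensive.
Import Order.TTheory GRing.Theory Num.Theory.
Local Open Scope ring_scope.

(* Substituting x = a - 1/a in F_n gives F_n(x)(a + 1/a) = a^n - (-1/a)^n, so the
   complex roots of Psi_n are the a - 1/a with -a^2 a primitive n-th root of unity.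
   Counting multiplicities, this is the identity over the integers
     X^phi(n) Psi_n(X - 1/X) = (-1)^phi(n) Phi_n(-X^2),   n >= 2,
   which can be reduced modulo p, where Phi_{p^k m} = Phi_m^phi(p^k).  In an
   algebraic closure of F_p the roots of Psi_n are then the b = a - 1/a with -a^2
   a primitive m-th root of unity; all have multiplicity phi(p^k), or 2 phi(p^k)
   when p = 2, because X^2 - a^2 is a square in characteristic 2.  The irreducible
   factors correspond to the Frobenius orbits of the roots: b^(p^d) = b exactly when
   a^(p^d) is a or -1/a, and the least such d > 0 is the delta of the statement. *)

(** * Factorization into monic irreducibles over the integers *)

Lemma int_unit_cases (c : int) : c \is a GRing.unit -> c = 1 \/ c = -1.
Proof. by rewrite qualifE /= => /orP[/eqP|/eqP]; [left|right]. Qed.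

Lemma monic_factor_unit (q : {poly int}) :
  q \is monic -> (1 < size q)%N -> ~~ (q \is a GRing.unit).
Proof. by move=> qm sq; rewrite poly_unitE; case: eqP sq => // ->. Qed.

(** The leading coefficients of [a] and [b] multiply to 1 in the integers, so both are 1 or both are
    -1; in the second case both factors are negated. *)
Lemma monic_mul_normalize (f a b : {poly int}) :
  f \is monic -> f = a * b ->
  exists a' b', [/\ a' \is monic, b' \is monic, f = a' * b',
    (a' \is a GRing.unit) = (a \is a GRing.unit) &
    (b' \is a GRing.unit) = (b \is a GRing.unit)].
Proof.
move=> fm fab; have /esym := monicP fm; rewrite fab lead_coefM => lab.
have /int_unit_cases [la|la] : lead_coef a \is a GRing.unit.
- by apply/unitrPr; exists (lead_coef b).
- exists a, b; split=> //; rewrite monicE ?la //.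
  by rewrite lab la mul1r.
- exists (- a), (- b); split; rewrite ?mulrNN ?unitrN //.
    by rewrite monicE lead_coefN la opprK.
  by rewrite monicE lead_coefN lab la mulN1r.
Qed.

Lemma monic_irr_factorization (f : {poly int}) : f \is monic ->
  exists2 s : seq {poly int}, {in s, forall q, monic_irr q} & f = \prod_(q <- s) q.
Proof.
have [n] := ubnP (size f); elim: n f => // n IH f; rewrite ltnS => sf fm.
have [sf1|sf1] := leqP (size f) 1.
  exists [::] => //; rewrite big_nil; move: fm; rewrite monicE => /eqP.
  by rewrite (size1_polyC sf1) lead_coefC => ->.
have [fi|nfi] := classic (monic_irr f).
  by exists [:: f]; rewrite ?big_seq1 // => q; rewrite inE => /eqP ->.
have [a [b [fab ua ub]]] : exists a b, [/\ f = a * b, ~~ (a \is a GRing.unit)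
    & ~~ (b \is a GRing.unit)].
  apply: NNPP => nab; apply: nfi; split=> // a b fab.
  apply: NNPP => nu; apply: nab; exists a, b; split=> //.
    by apply/negP => ua; apply: nu; left.
  by apply/negP => ua; apply: nu; right.
have [a' [b' [am bm fab' ua' ub']]] := monic_mul_normalize fm fab.
have nu1 (c : {poly int}) : c \is monic -> ~~ (c \is a GRing.unit) -> (1 < size c)%N.
  move=> cm; apply: contraNT; rewrite -leqNgt => c1.
  by move: cm; rewrite (size1_polyC c1) monicE lead_coefC => /eqP ->; rewrite unitr1.
have sa := nu1 _ am; have sb := nu1 _ bm; rewrite ua' in sa; rewrite ub' in sb.
move: (sa ua) (sb ub) => {}sa {}sb.
have ss : size f = (size a' + size b').-1 by rewrite fab' size_monicM ?monic_neq0.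
have [|s1 s1i a1] := IH a' _ am; first by move: sf ss sa sb; lia.
have [|s2 s2i b1] := IH b' _ bm; first by move: sf ss sa sb; lia.
exists (s1 ++ s2); last by rewrite big_cat /= -a1 -b1.
by move=> q; rewrite mem_cat => /orP[/s1i|/s2i].
Qed.

(** * Complex roots of monic irreducible polynomials, and existence of the fibotomic polynomial *)

Notation pZC := (map_poly (intr : int -> algC)).

(** Divisibility [%|] on [{poly int}] ignores nonzero constant factors, whereas [monic_irr] is about
    exact products. The link is that the primitive part of a divisor of [q] divides [q] exactly. *)
Lemma monic_irr_irreducible (q : {poly int}) : monic_irr q -> irreducible_poly q.
Proof.
case=> qm sq qi; split=> // d sd /dvdpP_int [r qdr].
have [ud|ur] := qi _ _ qdr.
  by case/negP: sd; move: ud; rewrite poly_unitE size_zprimitive => /andP[].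
move: ur; rewrite poly_unitE => /andP[/size_poly1P [c c0 rc] _].
have d0 : d != 0.
  by apply: contraTneq qm => d0; rewrite qdr d0 zprimitive0 mul0r monicE lead_coef0.
apply/eqpP; exists (c, zcontents d); first by rewrite c0 zcontents_eq0.
by rewrite /= qdr rc [in LHS](zpolyEprim d) mulrC mul_polyC !scalerA mulrC.
Qed.

Lemma pZC_rat (f : {poly int}) :
  pZC f = map_poly (ratr : rat -> algC) (map_poly intr f).
Proof.
rewrite -map_poly_comp; apply: eq_map_poly => z /=.
by rewrite ratr_int.
Qed.

(* Gauss' lemma: [q] remains irreducible over the rationals, so it is either
   coprime to [f] there or divides [f]. *)
Lemma monic_irr_dvd_root (q f : {poly int}) (b : algC) :
  monic_irr q -> root (pZC q) b -> root (pZC f) b -> zdvd q f.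
Proof.
move=> qi qb fb; have /irreducible_rat_int qQ := monic_irr_irreducible qi.
have := irreducible_poly_coprime (map_poly intr f) qQ.
have [/dvdpP_int [r ->]|ndv] := boolP (q %| f).
  by case: qi => qm _ _ _; exists r; rewrite zprimitive_monic.
rewrite dvdp_rat_int ndv /= -(coprimep_map (ratr : {rmorphism rat -> algC})) -!pZC_rat.
by move=> /coprimep_root/(_ qb)/negP; case.
Qed.

Lemma zdvd_root (q f : {poly int}) (b : algC) :
  zdvd q f -> root (pZC q) b -> root (pZC f) b.
Proof. by case=> r ->; rewrite rmorphM /= rootM => ->. Qed.

Lemma monic_irr_root (q : {poly int}) : monic_irr q -> exists b, root (pZC q) b.
Proof.
case=> qm sq _; apply/closed_rootP.
by rewrite size_map_poly_id0 ?(monicP qm) ?rmorph1 ?oner_neq0 // neq_ltn sq orbT.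
Qed.

(** By Gauss' lemma [q] divides [q'], the cofactor is a constant by irreducibility, and monicity
    makes it 1. Membership in a list of irreducibles can thus be tested on one root. *)
Lemma monic_irr_root_eq (q q' : {poly int}) (b : algC) :
  monic_irr q -> monic_irr q' -> root (pZC q) b -> root (pZC q') b -> q = q'.
Proof.
move=> qi qi' qb qb'; have [r q'r] := monic_irr_dvd_root qi qb qb'.
have [qm sq _] := qi; have [qm' sq' irr] := qi'.
have [|] := irr _ _ q'r; first by rewrite (negPf (monic_factor_unit qm sq)).
rewrite poly_unitE => /andP[/size_poly1P [c _ rc] _].
move: (monicP qm'); rewrite q'r rc lead_coefM (monicP qm) mul1r lead_coefC => ->.
by rewrite mulr1.
Qed.

Lemma monic_factor_root (f : {poly int}) (b : algC) :
  f \is monic -> root (pZC f) b ->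
  exists q, [/\ monic_irr q, zdvd q f & root (pZC q) b].
Proof.
move=> fm; have [s si ->] := monic_irr_factorization fm.
rewrite rmorph_prod /= /root horner_prod => /eqP/eqP.
rewrite prodf_seq_eq0 => /hasP [q qs /= qb]; exists q; split=> //; first exact: si.
by exists (\prod_(i <- rem q s) i); rewrite (big_rem _ qs).
Qed.

(** The witness keeps one copy of each irreducible factor of [Fib n] that divides no earlier
    [Fib k]; it gives [epsilon] in [Psi] its meaning. *)
Lemma fibotomic_exists (n : nat) : Fib n \is monic -> exists P, is_fibotomic n P.
Proof.
move=> Fm; have [s si Fs] := monic_irr_factorization Fm.
pose c q := forall k, (0 < k < n)%N -> ~ zdvd q (Fib k).
pose cb q := if excluded_middle_informative (c q) then true else false.
have cbP q : reflect (c q) (cb q).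
  by rewrite /cb; case: excluded_middle_informative => h; constructor.
pose t := [seq q <- undup s | cb q].
have ts q : q \in t -> [/\ monic_irr q, q \in s & c q].
  by rewrite mem_filter mem_undup => /andP[/cbP cq qs]; split=> //; apply: si.
have root_in (t' : seq {poly int}) q b : {subset t' <= t} -> monic_irr q ->
    root (pZC q) b -> root (pZC (\prod_(q <- t') q)) b -> q \in t'.
  move=> st qi qb; rewrite rmorph_prod /= /root horner_prod prodf_seq_eq0.
  case/hasP => q' q't /= q'b; rewrite (monic_irr_root_eq qi _ qb q'b) //.
  by case: (ts _ (st _ q't)).
have dvd_in q : q \in t -> zdvd q (\prod_(q <- t) q).
  by move=> qt; exists (\prod_(q <- rem q t) q); rewrite (big_rem _ qt).
have ut : uniq t by rewrite filter_uniq ?undup_uniq.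
exists (\prod_(q <- t) q); split.
- by rewrite big_seq; apply: monic_prod => q /ts [[]].
- move=> q qi; have [b qb] := monic_irr_root qi; split.
    move=> /zdvd_root/(_ qb)/(root_in _ _ _ (fun=> id) qi qb)/ts [_ qs cq].
    by split=> //; rewrite Fs; exists (\prod_(q <- rem q s) q); rewrite (big_rem _ qs).
  case=> qF cq; apply: dvd_in; rewrite mem_filter mem_undup; apply/andP; split.
    exact/cbP.
  have := zdvd_root qF qb; rewrite Fs rmorph_prod /= /root horner_prod prodf_seq_eq0.
  case/hasP => q' q's /= q'b; rewrite (monic_irr_root_eq qi _ qb q'b) //.
  exact: si.
- move=> q qi; have [b qb] := monic_irr_root qi => qq.
  have qt : q \in t.
    by apply: (root_in _ _ _ _ _ qb) => //; apply: zdvd_root qq _; rewrite rmorphM rootM qb.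
  (* Cancelling one [q] shows that [q] still divides the product over [rem q t], so it would occur
     twice in the duplicate-free list [t]. *)
  case: qq => r; rewrite (big_rem _ qt) /= -mulrA => /mulfI qr.
  have : q \in rem q t.
    apply: (root_in _ _ _ _ _ qb) => //; first exact: mem_rem.
    by rewrite qr ?rmorphM ?rootM ?qb // monic_neq0 //; case: qi.
  by rewrite mem_rem_uniq // inE eqxx.
Qed.

(** * Values of Fibonacci polynomials *)

Lemma FibSS (n : nat) : Fib n.+2 = 'X * Fib n.+1 + Fib n.
Proof. by []. Qed.

Lemma Fib_monic_size (n : nat) : Fib n.+1 \is monic /\ size (Fib n.+1) = n.+1.
Proof.
suff : (Fib n.+1 \is monic /\ size (Fib n.+1) = n.+1) /\ (size (Fib n) <= n)%N by case.
elim: n => [|n [[Fm Fs] Fs']]; first by rewrite /= monic1 size_poly1 size_poly0.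
have sX : size ('X * Fib n.+1) = n.+2.
  by rewrite mulrC size_mulX ?monic_neq0 // Fs.
split; last by rewrite Fs.
rewrite FibSS; split.
  by rewrite monicE lead_coefDl ?sX ?ltnS 1?ltnW //= lead_coefM lead_coefX mul1r.
by rewrite size_polyDl sX // ltnS ltnW.
Qed.

Section FibValues.
Variable L : fieldType.
Notation FL n := (map_poly (intr : int -> L) (Fib n)).

Lemma horner_FibSS (x : L) n : (FL n.+2).[x] = x * (FL n.+1).[x] + (FL n).[x].
Proof. by rewrite FibSS rmorphD rmorphM /= map_polyX !hornerE. Qed.

(** Binet's formula: [a] and [- a^-1] are the roots of t^2 - x t - 1 for x = a - 1/a, so both sides
    obey the Fibonacci recurrence. *)
Lemma Fib_sub_inv (a : L) n : a != 0 ->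
  (FL n).[a - a^-1] * (a + a^-1) = a ^+ n - (- a^-1) ^+ n.
Proof.
move=> a0; suff : (FL n).[a - a^-1] * (a + a^-1) = a ^+ n - (- a^-1) ^+ n /\
  (FL n.+1).[a - a^-1] * (a + a^-1) = a ^+ n.+1 - (- a^-1) ^+ n.+1 by case.
elim: n => [|n [IH0 IH1]].
  by rewrite rmorph0 rmorph1 !hornerE; split; field.
split=> //; rewrite horner_FibSS mulrDl -mulrA IH0 IH1 !exprS.
by field.
Qed.

(** The degenerate case of Binet's formula: if a^2 = -1 then -1/a = a is a double characteristic
    root, and a - 1/a = 2a. *)
Lemma Fib_double (a : L) n : a ^+ 2 = -1 -> (FL n.+1).[a *+ 2] = a ^+ n *+ n.+1.
Proof.
move=> a2; suff : (FL n.+1).[a *+ 2] = a ^+ n *+ n.+1 /\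
   (FL n.+2).[a *+ 2] = a ^+ n.+1 *+ n.+2 by case.
elim: n => [|n [IH0 IH1]].
  by rewrite horner_FibSS rmorph1 rmorph0 !hornerE.
split=> //; rewrite horner_FibSS IH0 IH1.
have -> : a ^+ n = - a ^+ n.+2 by rewrite -addn2 exprD a2 mulrN1 opprK.
rewrite mulrnAl mulrnAr -exprS -!mulrnA mulNrn -mulrnBr; last by lia.
by congr (_ *+ _); lia.
Qed.

Lemma Fib_root_sub_inv (a : L) n : a != 0 -> a ^+ 2 != -1 ->
  root (FL n) (a - a^-1) = ((- a ^+ 2) ^+ n == 1).
Proof.
move=> a0 a2; have a1 : a + a^-1 != 0.
  apply: contraNneq a2 => e; apply/eqP.
  have := congr1 ( *%R a) e; rewrite mulr0 mulrDr mulfV // -expr2 => /eqP.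
  by rewrite addr_eq0 => /eqP.
rewrite /root -(mulIr_eq0 _ (mulIf a1)) Fib_sub_inv // subr_eq0.
have -> : - a ^+ 2 = a * (- a^-1)^-1 by rewrite invrN invrK mulrN expr2.
by rewrite exprMn exprVn -[RHS](inj_eq (mulIf (expf_neq0 n (_ : - a^-1 != 0))))
  ?oppr_eq0 ?invr_eq0 // mul1r -mulrA mulVf ?mulr1 // expf_neq0 // oppr_eq0 invr_eq0.
Qed.

End FibValues.

(** * Root multiplicities in products of quadratics *)

Lemma size_prod_monic (R : nzRingType) (I : eqType) (s : seq I) (f : I -> {poly R}) d :
  {in s, forall i, f i \is monic /\ size (f i) = d.+1} ->
  size (\prod_(i <- s) f i) = (size s * d).+1.
Proof.
elim: s => [|i s IH] fs; first by rewrite big_nil size_poly1.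
have [fm sf] := fs i (mem_head _ _).
have fs' : {in s, forall i, f i \is monic /\ size (f i) = d.+1}.
  by move=> j js; apply: fs; rewrite inE js orbT.
rewrite big_cons size_monicM // ?sf ?IH ?mulSn ?addSn ?addnS //.
by rewrite monic_neq0 // big_seq; apply: monic_prod => j /fs' [].
Qed.

Section Multiplicity.
Variable L : fieldType.

Lemma mup_prod (I : Type) (s : seq I) (f : I -> {poly L}) (a : L) :
  (forall i, f i != 0) -> mup a (\prod_(i <- s) f i) = (\sum_(i <- s) mup a (f i))%N.
Proof.
move=> f0; elim: s => [|i s IH]; first by rewrite !big_nil mupNroot // root1.
rewrite !big_cons mupM ?IH // prodf_seq_neq0.
by apply: sub_all (all_predT s) => j _ /=.
Qed.

Lemma mup_exp (a : L) (q : {poly L}) n : q != 0 -> mup a (q ^+ n) = (n * mup a q)%N.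
Proof.
move=> q0; elim: n => [|n IH]; first by rewrite mupNroot // root1.
by rewrite exprS mupM ?expf_neq0 // IH mulSn.
Qed.

(** This is X (X - 1/X - b); its roots are the solutions a of a - 1/a = b. *)
Definition quad (b : L) : {poly L} := 'X^2 - b *: 'X - 1.

Lemma size_quad b : size (quad b) = 3.
Proof.
rewrite /quad -addrA -opprD size_polyDl ?size_polyXn //.
rewrite size_polyN (leq_ltn_trans (size_polyD _ _)) // gtn_max.
by rewrite size_poly1 (leq_ltn_trans (size_scale_leq _ _)) ?size_polyX.
Qed.

Lemma quad_monic b : quad b \is monic.
Proof.
by rewrite monicE lead_coefE size_quad /quad !coefE /= mulr0 !subr0.
Qed.

Lemma horner_quad0 b : (quad b).[0] = -1.
Proof. by rewrite /quad !hornerE; ring. Qed.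

Lemma horner_quad (a b : L) : a != 0 -> (quad b).[a] = a * ((a - a^-1) - b).
Proof. by move=> a0; rewrite /quad !hornerE; field. Qed.

(** The roots of [quad (a - a^-1)] are [a] and [- a^-1], which are distinct because a^2 is not
    -1. *)
Lemma mup_quad (a b : L) : a != 0 -> a ^+ 2 != -1 -> mup a (quad b) = (b == a - a^-1).
Proof.
move=> a0 a2; case: eqP => [->|/eqP nb]; last first.
  by rewrite mupNroot // /root horner_quad // mulf_neq0 // subr_eq0 eq_sym.
have -> : quad (a - a^-1) = ('X - a%:P) ^+ 1 * ('X - (- a^-1)%:P) ^+ 1.
  rewrite !expr1 mulrBl !mulrBr -!polyCM mulrN mulfV // polyCN -expr2.
  rewrite /quad -mul_polyC polyCB !polyCN; ring.
rewrite mupM ?expf_neq0 ?polyXsubC_eq0 // !mup_XsubCX eqxx.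
case: eqP => // e; case/negP: a2.
by rewrite expr2 -{1}e mulNr mulVf.
Qed.

Lemma mup_prod_quad (s : seq L) (a : L) : a != 0 -> a ^+ 2 != -1 ->
  mup a (\prod_(b <- s) quad b) = count_mem (a - a^-1) s.
Proof.
move=> a0 a2; rewrite mup_prod => [|b]; last by rewrite monic_neq0 ?quad_monic.
rewrite (eq_bigr _ (fun b _ => mup_quad b a0 a2)).
by elim: s => [|b s IH]; rewrite ?big_nil // big_cons IH.
Qed.

Lemma XsqrD_monic (w : L) : 'X^2 + w%:P \is monic.
Proof.
by rewrite monicE lead_coefDl ?lead_coefXn // size_polyXn size_polyC; case: eqP.
Qed.

Lemma size_XsqrD (w : L) : size ('X^2 + w%:P) = 3.
Proof. by rewrite size_polyDl ?size_polyXn // size_polyC; case: eqP. Qed.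

(* The multiplicity of a nonzero [a] as a root of [X^2 - a^2]. *)
Definition sqr_mult : nat := if 2%:R == 0 :> L then 2%N else 1%N.

Lemma mup_XsqrD (a w : L) : a != 0 ->
  mup a ('X^2 + w%:P) = ((w == - a ^+ 2) * sqr_mult)%N.
Proof.
move=> a0; case: eqP => [->|/eqP nw]; last first.
  by rewrite mupNroot // /root !hornerE addrC addr_eq0.
have -> : 'X^2 + (- a ^+ 2)%:P = ('X - a%:P) ^+ 1 * ('X - (- a)%:P) ^+ 1.
  by rewrite !expr1 !polyCN rmorphXn /=; ring.
rewrite mupM ?expf_neq0 ?polyXsubC_eq0 // !mup_XsubCX eqxx mul1n /sqr_mult.
have -> : (- a == a) = (2%:R == 0 :> L).
  by rewrite eq_sym -addr_eq0 -mulr2n -(mulr_natr a) mulf_eq0 (negPf a0).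
by case: eqP.
Qed.

Lemma mup_prod_XsqrD (s : seq L) (a : L) : a != 0 ->
  mup a (\prod_(w <- s) ('X^2 + w%:P)) = (count_mem (- a ^+ 2) s * sqr_mult)%N.
Proof.
move=> a0; rewrite mup_prod => [|b]; last by rewrite monic_neq0 ?XsqrD_monic.
rewrite (eq_bigr _ (fun b _ => mup_XsqrD b a0)) -big_distrl /=; congr muln.
by elim: s => [|b s IH]; rewrite ?big_nil // big_cons IH /=.
Qed.

End Multiplicity.

(** * Closed fields and the substitution of X - 1/X *)

Section ClosedField.
Variable L : closedFieldType.

Lemma monic_prod_roots (f : {poly L}) :
  f \is monic -> exists s : seq L, f = \prod_(z <- s) ('X - z%:P).
Proof.
move=> fm; have [s {1}->] := closed_field_poly_normal f; exists s.
by rewrite (monicP fm) scale1r.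
Qed.

Lemma eq_monic_mup (f g : {poly L}) : f \is monic -> g \is monic ->
  (forall a, mup a f = mup a g) -> f = g.
Proof.
move=> /monic_prod_roots [s ->] /monic_prod_roots [t ->] st.
apply: perm_big; apply/permP => P.
suff /permP : perm_eq s t by [].
by apply/allP => a _ /=; rewrite -!mu_prod_XsubC st.
Qed.

Lemma horner_neq0_inj (f g : {poly L}) :
  (forall a, a != 0 -> f.[a] = g.[a]) -> f = g.
Proof.
move=> fg; apply/eqP; rewrite -subr_eq0; apply: contraT => h0.
(* With h = f - g nonzero, X h + 1 has positive degree, hence a root; this root is nonzero and h
   does not vanish there. *)
have : size ('X * (f - g) + 1) != 1%N.
  have s2 : (1 < size ('X * (f - g)%R)%R)%N.
    by rewrite mulrC size_mulX // ltnS size_poly_gt0.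
  by rewrite size_polyDl ?size_poly1 // neq_ltn s2 orbT.
case/closed_rootP => a; rewrite /root !hornerE /=.
have [->|a0] := eqVneq a 0; first by rewrite mul0r add0r oner_eq0.
by rewrite fg // subrr mulr0 add0r oner_eq0.
Qed.

Lemma sub_inv_surj (b : L) : exists2 a, a != 0 & b = a - a^-1.
Proof.
have /closed_rootP [a] : size (quad b) != 1%N by rewrite size_quad.
have [->|a0] := eqVneq a 0; last first.
  rewrite /root horner_quad // mulf_eq0 (negPf a0) /= subr_eq0 => /eqP e.
  by exists a.
by rewrite /root horner_quad0 oppr_eq0 oner_eq0.
Qed.

End ClosedField.

Section Hom.

(* The polynomial [X^N f(X - 1/X)], for [f] of degree at most [N]. *)
Definition homog (R : comNzRingType) (N : nat) (f : {poly R}) : {poly R} :=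
  \sum_(i < N.+1) f`_i *: (('X^2 - 1) ^+ i * 'X^(N - i)).

(** Since [homog] is written on coefficients, an identity over the integers can be proved over the
    complex numbers and then reduced modulo p. *)
Lemma map_hom (R S : comNzRingType) (h : {rmorphism R -> S}) N f :
  map_poly h (homog N f) = homog N (map_poly h f).
Proof.
rewrite /homog rmorph_sum; apply: eq_bigr => i _ /=.
rewrite map_polyZ coef_map; congr (_ *: _).
by rewrite rmorphM !rmorphXn /= rmorphB /= rmorphXn /= rmorph1 map_polyX.
Qed.

Lemma horner_hom (L : fieldType) N (f : {poly L}) a : (size f <= N.+1)%N -> a != 0 ->
  (homog N f).[a] = a ^+ N * f.[a - a^-1].
Proof.
move=> sf a0; rewrite (horner_coef_wide _ sf) /homog horner_sum big_distrr /=.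
apply: eq_bigr => i _; rewrite hornerZ hornerM !horner_exp !hornerE /=.
have -> : a ^+ 2 - 1 = a * (a - a^-1) by field.
have -> : a ^+ N = a ^+ i * a ^+ (N - i) by rewrite -exprD subnKC // -ltnS.
by rewrite exprMn; ring.
Qed.

Lemma hom_prod_XsubC (L : closedFieldType) (s : seq L) :
  homog (size s) (\prod_(b <- s) ('X - b%:P)) = \prod_(b <- s) quad b.
Proof.
apply: horner_neq0_inj => a a0; rewrite horner_hom ?size_prod_XsubC //.
rewrite !horner_prod.
elim: s => [|b s IH]; first by rewrite !big_nil mulr1.
rewrite !big_cons -IH /= exprS horner_quad // !hornerE /=; ring.
Qed.

End Hom.

Lemma prod_comp_oppXsqr (R : comNzRingType) (s : seq R) :
  (\prod_(w <- s) ('X - w%:P)) \Po (- 'X^2) =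
  (-1) ^+ size s *: \prod_(w <- s) ('X^2 + w%:P).
Proof.
elim: s => [|w s IH]; first by rewrite !big_nil comp_polyC expr0 scale1r.
rewrite !big_cons comp_polyM IH comp_polyB comp_polyX comp_polyC /=.
by rewrite [(-1) ^+ _.+1]exprS -!mul_polyC polyCM polyCN; ring.
Qed.

Lemma Psi_fibotomic (n : nat) : (0 < n)%N -> is_fibotomic n (Psi n).
Proof.
case: n => // n _; apply: epsilon_spec; apply: fibotomic_exists.
by have [] := Fib_monic_size n.
Qed.

(** * Roots of cyclotomic polynomials over a field where n is nonzero *)

Section CyclotomicRoots.
Variables (L : fieldType) (n : nat).
Hypothesis nL0 : n%:R != 0 :> L.
Notation PhiL d := (map_poly (intr : int -> L) 'Phi_d).

Lemma prod_Cyclotomic_map (d : nat) : (0 < d)%N ->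
  \prod_(e <- divisors d) PhiL e = 'X^d - 1.
Proof.
move=> d0; rewrite -rmorph_prod prod_Cyclotomic //.
by rewrite rmorphB /= rmorphXn /= rmorph1 map_polyX.
Qed.

Lemma root_Cyclotomic_expr (d : nat) (w : L) : root (PhiL d) w -> w ^+ d = 1.
Proof.
case: d => [|d] r; first by rewrite expr0.
have := prod_Cyclotomic_map (ltn0Sn d); rewrite (big_rem d.+1) -?dvdn_divisors //=.
move=> /(congr1 (fun f => f.[w])); rewrite hornerM (rootP r) mul0r !hornerE => /eqP.
by rewrite eq_sym subr_eq0 => /eqP.
Qed.

Let n_gt0 : (0 < n)%N.
Proof. by rewrite lt0n; apply: contraNneq nL0 => ->. Qed.

Lemma Cyclotomic_separable : separable_poly (PhiL n).
Proof.
have := separable_Xn_sub_1 nL0; rewrite -prod_Cyclotomic_map //.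
by rewrite (big_rem n) -?dvdn_divisors //= separable_mul => /and3P[].
Qed.

(** If a root of Phi_n had order d < n, it would also be a root of some Phi_e with e dividing d,
    hence a double root of the separable X^n - 1. *)
Lemma root_Cyclotomic (w : L) : root (PhiL n) w = n.-primitive_root w.
Proof.
apply/idP/idP => [r|wn].
  have [d dw dn] := prim_order_exists n_gt0 (root_Cyclotomic_expr r).
  have [->//|dnn] := eqVneq n d.
  have d0 : (0 < d)%N by apply: dvdn_gt0 dn.
  have : root (\prod_(e <- divisors d) PhiL e) w.
    by rewrite prod_Cyclotomic_map // /root !hornerE (prim_expr_order dw) subrr.
  rewrite /root horner_prod prodf_seq_eq0 => /hasP [e] /=.
  rewrite -dvdn_divisors // => ed re.
  have en : e != n.
    by apply: contraNneq dnn => en; rewrite eqn_dvd dn -en ed.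
  have := separable_Xn_sub_1 nL0; rewrite -prod_Cyclotomic_map //.
  rewrite (big_rem n) -?dvdn_divisors //= separable_mul => /and3P[_ _].
  move=> /coprimep_root/(_ r)/negP; case.
  rewrite (big_rem e) /=; first by rewrite hornerM (eqP re) mul0r.
  by rewrite mem_rem_uniq ?divisors_uniq // inE en -dvdn_divisors // (dvdn_trans ed).
have : root (\prod_(e <- divisors n) PhiL e) w.
  by rewrite prod_Cyclotomic_map // /root !hornerE (prim_expr_order wn) subrr.
rewrite /root horner_prod prodf_seq_eq0 => /hasP [e] /=.
rewrite -dvdn_divisors // => en re.
suff -> : n = e by [].
by apply/eqP; rewrite eqn_dvd en andbT (prim_order_dvd wn) root_Cyclotomic_expr.
Qed.

End CyclotomicRoots.

(** * Complex roots of the fibotomic polynomial and the integral identity *)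

Section ComplexRoots.
Variables (n : nat) (P : {poly int}).
Hypotheses (n_gt0 : (0 < n)%N) (fibP : is_fibotomic n P).

Lemma fibotomic_root (b : algC) : root (pZC P) b <->
  root (pZC (Fib n)) b /\ forall k, (0 < k < n)%N -> ~ root (pZC (Fib k)) b.
Proof.
have [Pm Pd _] := fibP; split.
  move=> /(monic_factor_root Pm) [q [qi qP qb]]; have [qF qk] := (Pd q qi).1 qP.
  split=> [|k kn kb]; first exact: zdvd_root qF qb.
  by apply: (qk k kn); apply: monic_irr_dvd_root qi qb kb.
have Fm : Fib n \is monic by case: n n_gt0 => // n' _; have [] := Fib_monic_size n'.
case=> /(monic_factor_root Fm) [q [qi qF qb]] nk.
apply: (zdvd_root _ qb); apply/(Pd q qi); split=> // k kn qk.
by apply: (nk k kn); apply: zdvd_root qk qb.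
Qed.

(** Let [q] be the irreducible factor vanishing at [b]. The cofactor does not vanish there, as
    [q * q] does not divide [P]; and [q] has simple roots, as it cannot divide its derivative, which
    is nonzero of smaller degree. *)
Lemma fibotomic_simple (b : algC) : (mup b (pZC P) <= 1)%N.
Proof.
have [Pm _ Pq] := fibP.
have mapM0 (f : {poly int}) : f != 0 -> pZC f != 0.
  by move=> f0; rewrite map_poly_eq0_id0 ?intr_eq0 ?lead_coef_eq0.
have P0 := monic_neq0 Pm.
have [Pb|nPb] := boolP (root (pZC P) b); last by rewrite mupNroot.
have [q [qi [r Pqr] qb]] := monic_factor_root Pm Pb.
have [rb|nrb] := boolP (root (pZC r) b).
  have [t rt] := monic_irr_dvd_root qi qb rb.
  by case: (Pq q qi); exists t; rewrite Pqr rt mulrA.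
have q0 : q != 0 by apply: contraNneq P0 => q0; rewrite Pqr q0 mul0r.
rewrite Pqr rmorphM /= mupMl // leqNgt mup_geq ?mapM0 //.
apply/negP => /dvdpP [t qt].
have qb' : root (pZC q^`()) b.
  by rewrite -deriv_map qt /root derivM expr2 derivM !hornerE /= subrr !(mulr0, mul0r, addr0).
have [qm sq _] := qi; have [s q's] := monic_irr_dvd_root qi qb qb'.
have q'0 : q^`() != 0.
  case sqE : (size q) sq => [|[|k]] // _.
  apply/eqP => /polyP/(_ k); rewrite coef_deriv coef0.
  by have := monicP qm; rewrite lead_coefE sqE /= => -> /eqP; rewrite pnatr_eq0.
have s0 : s != 0 by apply: contraNneq q'0 => s0; rewrite q's s0 mulr0.
have := lt_size_deriv q0; rewrite q's size_monicM //.
by move: s0 sq; rewrite -size_poly_gt0; lia.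
Qed.

(** Over the complex numbers the two sides become products of [quad b], over the roots b of [P], and
    of X^2 + w, over the primitive n-th roots of unity w. These are compared by the multiplicity of
    each a. *)
Lemma fibotomic_hom : (1 < n)%N ->
  size P = (totient n).+1 /\
  homog (totient n) P = (-1) ^+ totient n *: ('Phi_n \Po (- 'X^2)).
Proof.
move=> n_gt1; have [z zP] := C_prim_root_exists n_gt0.
have [Pm _ _] := fibP.
have PCm : pZC P \is monic by apply: monic_map.
have [rs rsP] := monic_prod_roots PCm.
have PhiCm : pZC 'Phi_n \is monic by apply: monic_map; exact: Cyclotomic_monic.
have [ws wsP] := monic_prod_roots PhiCm.
have rs1 b : count_mem b rs = root (pZC P) b.
  have := fibotomic_simple b; rewrite rsP mu_prod_XsubC root_prod_XsubC.
  by rewrite -has_pred1 has_count; case: (count_mem b rs) => [|[]].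
have nC0 : n%:R != 0 :> algC by rewrite pnatr_eq0 -lt0n.
have uws : uniq ws by rewrite -separable_prod_XsubC -wsP Cyclotomic_separable.
have ws1 w : count_mem w ws = n.-primitive_root w.
  by rewrite count_uniq_mem // -root_prod_XsubC -wsP root_Cyclotomic.
have mon_q (s : seq algC) : \prod_(b <- s) quad b \is monic.
  by apply: monic_prod => b _; apply: quad_monic.
have mon_w (s : seq algC) : \prod_(w <- s) ('X^2 + w%:P) \is monic.
  by apply: monic_prod => w _; apply: XsqrD_monic.
have eqQ : \prod_(b <- rs) quad b = \prod_(w <- ws) ('X^2 + w%:P).
  apply: eq_monic_mup => // a.
  have [->|a0] := eqVneq a 0.
    rewrite !mupNroot // /root horner_prod prodf_seq_neq0; apply/allP => c; last first.
      by move=> _; rewrite horner_quad0 oppr_eq0 oner_eq0.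
    rewrite -has_pred1 has_count ws1 lt0b => cp; rewrite /= !hornerE expr0n add0r.
    by rewrite (prim_root_eq0 cp) -lt0n.
  (* For a^2 = -1 neither side vanishes: on the right 1 would be a primitive n-th root of unity with
     n > 1, and on the left F_n(2a) = n a^(n-1) would be 0. *)
  have [a2|a2] := eqVneq (a ^+ 2) (-1).
    rewrite !mupNroot //; apply/negP.
      rewrite /root horner_prod prodf_seq_eq0 => /hasP [w]; rewrite -has_pred1 has_count.
      rewrite ws1 lt0b !hornerE a2 /= addrC subr_eq0 => wp /eqP w1; move: wp.
      rewrite w1 => w1p; move: (prim_order_dvd w1p 1); rewrite expr1n eqxx dvdn1.
      by rewrite gtn_eqF.
    rewrite /root horner_prod prodf_seq_eq0 => /hasP [b]; rewrite -has_pred1 has_count.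
    rewrite rs1 lt0b /= horner_quad // mulf_eq0 (negPf a0) /= subr_eq0 => bP /eqP b2.
    have [+ _] := (fibotomic_root b).1 bP.
    have <- : a *+ 2 = b.
      rewrite -b2 mulr2n; congr (_ + _); apply: (mulfI a0).
      by rewrite mulrN mulfV // -expr2.
    case: n n_gt0 => // n' _; rewrite /root Fib_double // mulrn_eq0 /=.
    by rewrite expf_eq0 (negPf a0) andbF.
  rewrite mup_prod_quad // mup_prod_XsqrD // rs1 ws1 /sqr_mult pnatr_eq0 /= muln1.
  congr nat_of_bool; apply/idP/idP.
    move=> /fibotomic_root []; rewrite Fib_root_sub_inv // => /eqP an ak.
    (* If the order m of -a^2 were smaller than n, then F_m would already vanish at a - 1/a. *)
    have [m mp mn] := prim_order_exists n_gt0 an.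
    have [<- //|nm] := eqVneq m n.
    case: (ak m); last by rewrite Fib_root_sub_inv // (prim_expr_order mp).
    by rewrite (prim_order_gt0 mp) ltn_neqAle nm dvdn_leq.
  move=> ap; apply/fibotomic_root; rewrite Fib_root_sub_inv // (prim_expr_order ap).
  split=> // k /andP[k0 kn]; rewrite Fib_root_sub_inv // -(prim_order_dvd ap).
  by move=> /(dvdn_leq k0); rewrite leqNgt kn.
have sws : size ws = totient n.
  have := size_map_inj_poly (@intr_inj algC) (rmorph0 _) 'Phi_n.
  by rewrite wsP size_Cyclotomic size_prod_XsubC => -[].
(* Comparing degrees in [eqQ], where all factors are quadratic, gives the degree of [P]. *)
have srs : size rs = totient n.
  have := congr1 (fun f : {poly algC} => size f) eqQ.
  rewrite (@size_prod_monic _ _ _ _ 2) => [|b _]; last by rewrite quad_monic size_quad.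
  rewrite (@size_prod_monic _ _ _ _ 2) => [|b _]; last by rewrite XsqrD_monic size_XsqrD.
  by move=> [] /eqP; rewrite eqn_mul2r sws => /eqP.
split.
  have := size_map_inj_poly (@intr_inj algC) (rmorph0 _) P.
  by rewrite rsP size_prod_XsubC srs.
apply: (map_inj_poly (@intr_inj algC)); first exact: rmorph0.
rewrite map_hom rsP -srs hom_prod_XsubC eqQ srs map_polyZ map_comp_poly wsP.
rewrite rmorphN /= map_polyXn prod_comp_oppXsqr sws scalerA rmorphXn /= rmorphN rmorph1.
by rewrite -exprMn mulrNN mulr1 expr1n scale1r.
Qed.

End ComplexRoots.

(** * Cyclotomic polynomials in characteristic p *)

Lemma divisors_pfactorS (p k m : nat) : prime p -> (0 < m)%N -> coprime p m ->
  perm_eq (divisors (p ^ k.+1 * m))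
    (divisors (p ^ k * m) ++ [seq (p ^ k.+1 * d)%N | d <- divisors m]).
Proof.
move=> pp m0 pm; have p0 := prime_gt0 pp.
have ltp : (p ^ k < p ^ k.+1)%N by rewrite ltn_exp2l // prime_gt1.
have pm0 j : (0 < p ^ j * m)%N by rewrite muln_gt0 expn_gt0 p0.
apply: uniq_perm; first exact: divisors_uniq.
  rewrite cat_uniq divisors_uniq map_inj_uniq ?divisors_uniq ?andbT /=; last first.
    by move=> x y /eqP; rewrite eqn_pmul2l ?expn_gt0 ?p0 // => /eqP.
  apply/hasPn => _ /mapP [d _ ->]; rewrite -dvdn_divisors //; apply/negP => dv.
  have : (p ^ k.+1 %| p ^ k * m)%N by apply: dvdn_trans dv; rewrite dvdn_mulr.
  rewrite Gauss_dvdl ?coprimeXl // => /dvdn_leq; rewrite expn_gt0 p0 => /(_ isT).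
  by rewrite leqNgt ltp.
move=> e; rewrite mem_cat -!dvdn_divisors //; apply/idP/orP => [dv|[dv|]].
- have [/dvdnP [d ed]|npe] := boolP (p ^ k.+1 %| e)%N.
    right; apply/mapP; exists d; last by rewrite mulnC.
    by move: dv; rewrite ed mulnC -dvdn_divisors // dvdn_pmul2l // expn_gt0 p0.
  have e0 : (0 < e)%N by apply: dvdn_gt0 dv; apply: pm0.
  left; have [e' pe' ee'] := pfactor_coprime pp e0.
  rewrite ee' mulnC dvdn_mul //.
    by rewrite dvdn_exp2l // leqNgt -pfactor_dvdn.
  rewrite -(@Gauss_dvdr _ (p ^ k.+1)) ?coprimeXr 1?coprime_sym //.
  by apply: dvdn_trans dv; rewrite ee' dvdn_mulr.
- by apply: dvdn_trans dv _; rewrite dvdn_pmul2r // dvdn_exp2l.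
- move=> /mapP [d]; rewrite -dvdn_divisors // => dm ->.
  by rewrite dvdn_pmul2l // expn_gt0 p0.
Qed.

(** Strong induction on m. Dividing X^(p^(k+1) m) - 1 by X^(p^k m) - 1 leaves the product of
    Phi_(p^(k+1) d) over d dividing m; in characteristic p it equals (X^m - 1)^(p^(k+1) - p^k). The
    factors with d < m cancel by induction. *)
Lemma Cyclotomic_pchar (L : fieldType) (p k m : nat) : p \in [pchar L] ->
  (0 < m)%N -> coprime p m ->
  map_poly (intr : int -> L) 'Phi_(p ^ k * m) =
  map_poly intr 'Phi_m ^+ totient (p ^ k).
Proof.
move=> pL; have pp := pcharf_prime pL; have p0 := prime_gt0 pp.
case: k => [|k]; first by rewrite expn0 mul1n expr1.
have [n] := ubnP m; elim: n m => // n IH m; rewrite ltnS => mn m0 pm.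
pose PhiL d := map_poly (intr : int -> L) 'Phi_d.
have Phi0 d : PhiL d != 0 by rewrite monic_neq0 // monic_map // Cyclotomic_monic.
have PX j : \prod_(d <- divisors (p ^ j * m)) PhiL d = ('X^m - 1) ^+ (p ^ j).
  rewrite prod_Cyclotomic_map ?muln_gt0 ?expn_gt0 ?p0 // mulnC exprM.
  have pL' : p \in [pchar {poly L}] by rewrite pchar_poly.
  rewrite -[X in X ^+ _ - 1](subrK 1) exprDn_pchar ?expr1n ?addrK //.
  by rewrite pnatX (eq_pnat _ (pcharf_eq pL')) pnat_id.
have X0 : 'X^m - 1 != 0 :> {poly L} by rewrite -size_poly_eq0 size_XnsubC.
have : \prod_(d <- divisors m) PhiL (p ^ k.+1 * d)%N = ('X^m - 1) ^+ totient (p ^ k.+1).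
  have := PX k.+1; rewrite (perm_big _ (divisors_pfactorS k pp m0 pm)) big_cat /= PX big_map.
  have {2}-> : (p ^ k.+1 = p ^ k + totient (p ^ k.+1))%N.
    by rewrite totient_pfactor // -mulSn prednK // expnS.
  by rewrite exprD => /(mulfI (expf_neq0 _ X0)).
have mm : m \in divisors m by rewrite -dvdn_divisors.
rewrite -prod_Cyclotomic_map // -prodrXl (big_rem m mm) [in RHS](big_rem m mm) /=.
have -> : \prod_(d <- rem m (divisors m)) PhiL (p ^ k.+1 * d)%N =
   \prod_(d <- rem m (divisors m)) PhiL d ^+ totient (p ^ k.+1).
  apply: eq_big_seq => d; rewrite mem_rem_uniq ?divisors_uniq // inE -dvdn_divisors //.
  move=> /andP[dm dvm]; apply: IH.
  - by apply: leq_trans mn; rewrite ltn_neqAle dm dvdn_leq.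
  - exact: dvdn_gt0 dvm.
  - exact: coprime_dvdr dvm pm.
apply: mulIf; rewrite prodf_seq_neq0; apply/allP => d _ /=.
exact: expf_neq0.
Qed.

(** * Frobenius orbits and irreducible factors over F_p *)

Section Frobenius.
Variables (p : nat) (K : closedFieldType) (phi : {rmorphism 'F_p -> K}).
Hypothesis pp : prime p.

Lemma pcharK : p \in [pchar K].
Proof. exact: (rmorph_pchar phi (pchar_Fp pp)). Qed.

Notation Fr := (pFrobenius_aut pcharK).

(** X^p - X is the product of X - x over x in F_p, so its roots in [K] all come from F_p. *)
Lemma Frobenius_fixed (c : K) : c ^+ p = c -> exists x, c = phi x.
Proof.
move=> cp; have := congr1 (fun f => (map_poly phi f).[c]) (finField_genPoly 'F_p).
rewrite /= card_Fp // rmorphB /= map_polyXn map_polyX !hornerE cp subrr.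
rewrite rmorph_prod /= horner_prod => /esym/eqP/prodf_eq0 [x _].
by rewrite map_polyXsubC !hornerE subr_eq0 => /eqP ->; exists x.
Qed.

Lemma Frobenius_fixed_poly (f : {poly K}) :
  map_poly Fr f = f -> exists g, f = map_poly phi g.
Proof.
(* [pre] is a set-theoretic inverse of [phi]; [pre 0 = 0] makes [map_poly pre] act coefficient by
   coefficient. *)
move=> fF; pose pre c := odflt 0 [pick x | phi x == c].
have pre0 : pre 0 = 0.
  rewrite /pre; case: pickP => //= x; rewrite fmorph_eq0 => /eqP //.
exists (map_poly pre f); apply/polyP => i; rewrite coef_map coef_map_id0 //= /pre.
have [x fx] : exists x, f`_i = phi x.
  by apply: Frobenius_fixed; rewrite -{2}fF coef_map.
by case: pickP => [y /eqP //|/(_ x)]; rewrite fx eqxx.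
Qed.

Lemma root_Frobenius (g : {poly 'F_p}) (z : K) i :
  root (map_poly phi g) z -> root (map_poly phi g) (z ^+ (p ^ i)).
Proof.
elim: i z => [|i IH] z rz; first by rewrite expr1.
rewrite expnS exprM; apply: IH.
rewrite -(pFrobenius_autE pcharK) /root.
have -> : map_poly phi g = map_poly Fr (map_poly phi g).
  rewrite -map_poly_comp; apply: eq_map_poly => x /=.
  rewrite pFrobenius_autE -rmorphXn /=.
  by have := expf_card x; rewrite card_Fp // => ->.
by rewrite horner_map (eqP rz) rmorph0.
Qed.

Lemma expr_iterate_inj i : injective (fun z : K => z ^+ (p ^ i)).
Proof.
elim: i => [|i IH] x y; first by rewrite !expr1.
by rewrite expnS !exprM => /IH; rewrite -!(pFrobenius_autE pcharK) => /fmorph_inj.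
Qed.

(** For d > 0 this says that b has degree d over F_p. *)
Definition Frobenius_period (d : nat) (b : K) : Prop :=
  b ^+ (p ^ d) = b /\ forall i, (0 < i < d)%N -> b ^+ (p ^ i) <> b.

Section Orbit.
Variables (d : nat) (b : K).
Hypotheses (d_gt0 : (0 < d)%N) (perb : Frobenius_period d b).

Definition Forbit : seq K := [seq b ^+ (p ^ i) | i <- iota 0 d].

Lemma Forbit_uniq : uniq Forbit.
Proof.
have lt_ne i j : (i < j < d)%N -> b ^+ (p ^ i) <> b ^+ (p ^ j).
  move=> /andP[ij jd] e; apply: (perb.2 (j - i)%N).
    by rewrite subn_gt0 ij (leq_ltn_trans (leq_subr _ _)).
  by apply: (@expr_iterate_inj i); rewrite /= -exprM -expnD subnK // ltnW.
rewrite map_inj_in_uniq ?iota_uniq // => i j; rewrite !mem_iota !add0n => /= id jd e.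
by case: (ltngtP i j) => // ij; [case: (lt_ne i j) | case: (lt_ne j i)]; rewrite ?ij.
Qed.

Lemma Forbit_Frobenius_closed : perm_eq [seq z ^+ p | z <- Forbit] Forbit.
Proof.
have im : uniq [seq z ^+ p | z <- Forbit].
  rewrite map_inj_uniq ?Forbit_uniq // => x y /=.
  by rewrite -!(pFrobenius_autE pcharK) => /fmorph_inj.
have sub : {subset [seq z ^+ p | z <- Forbit] <= Forbit}.
  move=> _ /mapP [_ /mapP [i + ->] ->]; rewrite mem_iota add0n => /= id.
  rewrite -exprM -expnSr; have [ed|ni] := eqVneq i.+1 d.
    by apply/mapP; exists 0%N; rewrite ?mem_iota // ed perb.1 expr1.
  by apply/mapP; exists i.+1; rewrite ?mem_iota //= add0n ltn_neqAle ni.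
have le : (size Forbit <= size [seq z ^+ p | z <- Forbit])%N by rewrite size_map.
have [_ e] := uniq_min_size im sub le.
by apply: uniq_perm e; rewrite ?Forbit_uniq.
Qed.

(** Frobenius permutes the orbit, so the orbit product has coefficients in F_p. A nonconstant
    divisor over F_p has a root in the orbit, hence contains the whole orbit among its roots. *)
Lemma Forbit_irreducible : exists q : {poly 'F_p},
  [/\ q \is monic, size q = d.+1, irreducible_poly q &
      map_poly phi q = \prod_(z <- Forbit) ('X - z%:P)].
Proof.
have [|q /esym qE] := @Frobenius_fixed_poly (\prod_(z <- Forbit) ('X - z%:P)).
  rewrite rmorph_prod /= -[RHS](perm_big _ Forbit_Frobenius_closed) /= big_map.
  by apply: eq_bigr => z _; rewrite map_polyXsubC.
have sq : size q = d.+1.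
  by rewrite -(size_map_poly phi) qE size_prod_XsubC size_map size_iota.
exists q; split=> //.
  by rewrite -(map_monic phi) qE monic_prod_XsubC.
split=> [|g sg gq]; first by rewrite sq ltnS.
have /closed_rootP [z gz] : size (map_poly phi g) != 1%N by rewrite size_map_poly.
have zO : z \in Forbit.
  rewrite -root_prod_XsubC -qE; have [h ->] := dvdpP _ _ gq.
  by rewrite rmorphM /= rootM gz orbT.
rewrite /eqp gq -(dvdp_map phi) qE uniq_roots_dvdp ?uniq_rootsE ?Forbit_uniq //.
move: zO => /mapP [i + zi]; rewrite mem_iota add0n => /= id.
apply/allP => _ /mapP [j _ ->].
(* From [z = b ^+ (p ^ i)], another d - i steps return to [b], and j more reach the target. *)
have -> : b ^+ (p ^ j) = z ^+ (p ^ (d - i + j)).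
  by rewrite zi -exprM -expnD addnA subnKC 1?ltnW // expnD exprM perb.1.
exact: root_Frobenius.
Qed.

End Orbit.

(** Induction on the size of [B]: the orbit of the first element is split off, and the rest stays
    closed because Frobenius permutes that orbit. *)
Lemma Frobenius_closed_prod (d : nat) (B : seq K) : (0 < d)%N -> uniq B ->
  {in B, forall b, b ^+ p \in B} -> {in B, forall b, Frobenius_period d b} ->
  exists qs : seq {poly 'F_p},
    [/\ uniq qs, (size qs * d)%N = size B, all (fun q => q \is monic) qs,
        forall q, q \in qs -> irreducible_poly q /\ size q = d.+1 &
        \prod_(q <- qs) map_poly phi q = \prod_(b <- B) ('X - b%:P)].
Proof.
move=> d0; have [n] := ubnP (size B); elim: n B => // n IH [|b B0].
  by exists [::]; rewrite !big_nil.
set B := b :: B0 => sB uB cB pB.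
have bB : b \in B by rewrite mem_head.
have perb := pB b bB; have [q [qm sq qi qE]] := Forbit_irreducible d0 perb.
have OB : {subset Forbit d b <= B}.
  move=> _ /mapP [i _ ->]; elim: i => [|i IHi]; first by rewrite expr1.
  by rewrite expnSr exprM; apply: cB.
have uO := Forbit_uniq perb.
pose C := [seq c <- B | c \notin Forbit d b].
have pBC : perm_eq B (Forbit d b ++ C).
  apply: uniq_perm => // [|x].
    rewrite cat_uniq uO filter_uniq // andbT; apply/hasPn => x.
    by rewrite mem_filter => /andP[].
  by rewrite mem_cat mem_filter; case: (boolP (x \in Forbit d b)) => //= /OB ->.
have sBC : size B = (d + size C)%N.
  by rewrite (perm_size pBC) size_cat size_map size_iota.
have CB : {subset C <= B} by move=> x; rewrite mem_filter => /andP[].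
have [||x|x /CB|qs [uqs sqs mqs iqs qsE]] := IH C.
- by move: sB d0; rewrite sBC; move: (size C) => c; lia.
- exact: filter_uniq.
- rewrite !mem_filter => /andP[xO xB]; rewrite cB // andbT.
  apply: contraNN xO => xpO.
  have := perm_mem (Forbit_Frobenius_closed d0 perb) (x ^+ p); rewrite xpO.
  move=> /mapP [z zO]; rewrite -!(pFrobenius_autE pcharK) => /fmorph_inj ->.
  exact: zO.
- exact: pB.
have bO : b \in Forbit d b.
  by apply/mapP; exists 0%N; rewrite ?expr1 // mem_iota.
exists (q :: qs); split.
- rewrite /= uqs andbT; apply/negP => qqs.
  have : b \in C.
    rewrite -root_prod_XsubC -qsE (big_rem _ qqs) /= rootM qE.
    by rewrite root_prod_XsubC bO.
  by rewrite mem_filter bO.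
- by rewrite sBC -sqs -mulSn.
- by rewrite /= qm.
- by move=> q'; rewrite inE => /predU1P [->|/iqs].
- by rewrite big_cons qE qsE (perm_big _ pBC) big_cat.
Qed.

End Frobenius.

(** * Multiplicative orders and the arithmetic of delta *)

Lemma even_mod4 (u : nat) : ~~ odd u -> (u %% 4 = (odd u./2).*2)%N.
Proof.
move=> eu; rewrite -{1}(even_halfK eu) -!muln2 -[4%N]/(2 * 2)%N -muln_modl.
by rewrite modn2.
Qed.

Lemma leq_half (n : nat) : (n./2 <= n)%N.
Proof. by rewrite leq_half_double -addnn leqW ?leq_addr. Qed.

Lemma dvdn_double_small (u i : nat) : (0 < i < u)%N -> (u %| i.*2)%N -> i.*2 = u.
Proof.
move=> /andP[i0 iu] /dvdnP [[|[|q]] e]; first by lia.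
  by rewrite e mul1n.
by move: e; rewrite !mulSn; lia.
Qed.

Section Order.
Local Open Scope nat_scope.
Variables a n : nat.
Hypotheses (n_gt1 : 1 < n) (an : coprime a n).

(** The search in [ordmod] succeeds: by Euler the exponent [totient n] works, and its index
    [(totient n).-1] is below n. *)
Lemma expn_ordmod : a ^ ordmod a n = 1 %[mod n].
Proof.
have n0 : 0 < n by apply: ltnW.
have t0 : 0 < totient n by rewrite totient_gt0.
have tn : totient n <= n.
  rewrite totient_count_coprime big_mkord.
  by rewrite (leq_trans (leq_sum _ (fun i _ => leq_b1 _))) // sum1_card card_ord.
pose P k := a ^ k.+1 == 1 %[mod n].
have hP : has P (iota 0 n).
  apply/hasP; exists (totient n).-1; first by rewrite mem_iota /= add0n prednK.
  by rewrite /P prednK // Euler_exp_totient.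
have := nth_find 0 hP; rewrite nth_iota ?add0n; first by move/eqP.
by move: hP; rewrite has_find size_iota.
Qed.

Lemma ordmod_min i : 0 < i < ordmod a n -> a ^ i <> 1 %[mod n].
Proof.
case: i => // i; rewrite /ordmod ltnS /= => iu /eqP e.
set P := (fun k => _) in iu.
have := before_find 0 iu; rewrite nth_iota ?add0n /P ?e //.
by have := find_size P (iota 0 n); rewrite size_iota => h; apply: leq_trans h.
Qed.

Lemma ordmod_dvd i : (ordmod a n %| i) = (a ^ i == 1 %[mod n]).
Proof.
have e (q : nat) : a ^ (q * ordmod a n) = 1 %[mod n].
  by rewrite mulnC expnM -modnXm expn_ordmod modnXm exp1n.
apply/idP/eqP => [/dvdnP [q ->] //|].
rewrite {1}(divn_eq i (ordmod a n)) expnD -modnMml e modnMml mul1n => r1.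
case: (posnP (i %% ordmod a n)) => [/eqP //|r0].
by case: (@ordmod_min (i %% ordmod a n)) => //; rewrite r0 ltn_mod.
Qed.

End Order.

Lemma expn_mod4 (p i : nat) : odd p ->
  (p ^ i %% 4)%N = if (p %% 4 == 1)%N || ~~ odd i then 1%N else 3.
Proof.
move=> po; have p4 : (p %% 4 = 1 \/ p %% 4 = 3)%N by lia.
elim: i => [|i IH]; first by rewrite orbT.
rewrite expnS -modnMmr IH -modnMml /=.
by case: p4 => -> //=; case: (odd i).
Qed.

Section OddDegree.
Local Open Scope nat_scope.
Variables p m : nat.
Hypotheses (p_pr : prime p) (p_gt2 : 2 < p) (m_gt2 : 2 < m) (pm : coprime p m).

(* Whether the [i]-th power of Frobenius fixes [a - 1/a], for [a = j z] with
   [j^2 = -1] and [z] a primitive [2m]-th root of unity: it fixes [j] iff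
   [p^i = 1] modulo 4, and [-1 = z^m]. *)
Definition odd_cond (i : nat) : bool :=
  let r := p ^ i %% (2 * m) in
  if p ^ i %% 4 == 1 then (r == 1) || (r == (2 * m).-1)
  else (r == m.+1) || (r == m.-1).

Let p_odd : odd p. Proof. by case: (even_prime p_pr) p_gt2 => [->|]. Qed.

Let p2m : coprime p (2 * m).
Proof. by rewrite coprimeMr pm andbT coprimen2. Qed.

Let m2 : 1 < 2 * m. Proof. by lia. Qed.

Let u := ordmod p (2 * m).

Let u_gt0 : 0 < u. Proof. by []. Qed.

Let dvd_u i : (u %| i) = (p ^ i %% (2 * m) == 1).
Proof. by rewrite /u ordmod_dvd // (modn_small m2). Qed.

Let sqr_mod i x : p ^ i %% (2 * m) = x -> x ^ 2 = 1 %[mod 2 * m] -> u %| i.*2.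
Proof. by move=> <-; rewrite modnXm -expnM muln2 dvd_u => ->; rewrite modn_small. Qed.

(** Every residue allowed by [odd_cond] squares to 1 modulo 2m. For m + 1 and m - 1 this uses that m
    is even, which holds because p^i is odd. *)
Lemma odd_cond_dvd i : odd_cond i -> u %| i.*2.
Proof.
rewrite /odd_cond; set r := p ^ i %% (2 * m).
have rE : r %% 2 = 1.
  rewrite /r modn_dvdm ?dvdn_mulr // modn2 oddX p_odd orbT //.
case: ifP => _ /orP[] /eqP rv; apply: (sqr_mod rv).
- by rewrite exp1n.
- have -> : (2 * m).-1 ^ 2 = (2 * m - 2) * (2 * m) + 1 by move: m_gt2; nia.
  by rewrite modnMDl.
- move: rE; rewrite rv => m1; have [t mt] : exists t, m = 2 * t by exists (m %/ 2); lia.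
  have -> : m.+1 ^ 2 = (t + 1) * (2 * m) + 1 by rewrite mt; nia.
  by rewrite modnMDl.
- move: rE; rewrite rv => m1; have [t mt] : exists t, m = 2 * t by exists (m %/ 2); lia.
  have -> : m.-1 ^ 2 = (t - 1) * (2 * m) + 1 by rewrite mt; move: m_gt2; rewrite mt; nia.
  by rewrite modnMDl.
Qed.

Lemma odd_cond_ndvd i : odd_cond i -> u %| i -> p ^ i %% 4 = 1.
Proof.
rewrite /odd_cond dvd_u; case: eqP => // _ h /eqP r1; move: h; rewrite r1.
by move: m_gt2; lia.
Qed.

(** Since the condition at i forces u to divide 2i, below u only u/2 can satisfy it. The exponent u
    itself does, unless p = 3 modulo 4 and u is odd; then 2u is the first. *)
Lemma delta_oddP : [/\ 0 < delta_odd p m, odd_cond (delta_odd p m) &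
  forall i, 0 < i < delta_odd p m -> ~~ odd_cond i].
Proof.
have p4 : p %% 4 = 1 \/ p %% 4 = 3 by have := p_odd; lia.
have cu : p %% 4 = 1 \/ ~~ odd u -> odd_cond u.
  move=> c; rewrite /odd_cond (expn_mod4 _ p_odd).
  have -> : (p %% 4 == 1) || ~~ odd u by case: c => ->; rewrite ?orbT.
  by rewrite -dvd_u dvdnn.
rewrite /delta_odd -/u.
set b := [|| _, _ | _].
have bE : ~~ odd u -> b = odd_cond u./2.
  (* By minimality of u, p^(u/2) is not 1 modulo 2m, so that alternative of [odd_cond] drops out and
     the three clauses of [delta_odd] remain. *)
  move=> eu; have uh : u = u./2.*2 by rewrite even_halfK.
  have h0 : 0 < u./2 by rewrite -double_gt0 -uh.
  have nu : (p ^ u./2 %% (2 * m) == 1) = false.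
    rewrite -dvd_u; apply/negP => /(dvdn_leq h0); rewrite leqNgt {2}uh.
    by rewrite -addnn -{1}[u./2]addn0 ltn_add2l h0.
  rewrite /b /odd_cond (expn_mod4 _ p_odd) nu /= eu (even_mod4 eu).
  by case: p4 => -> /=; case: (odd u./2); rewrite /= ?orbF.
have bu : b -> ~~ odd u.
  have odd4 (v : nat) : odd (v %% 4) = odd v.
    by rewrite -[in RHS](odd_mod v (erefl : odd 4 = false)).
  rewrite -[odd u]odd4 /b => /or3P[/and3P[_ + _]|/and3P[_ /eqP -> //]|/and3P[_ /eqP -> //]].
  by rewrite odd4.
have small i : 0 < i < u -> odd_cond i -> i.*2 = u.
  by move=> iu /odd_cond_dvd; apply: dvdn_double_small.
have half_gt0 : ~~ odd u -> 0 < u./2 by move=> eu; rewrite -double_gt0 even_halfK.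
have half_small i : 0 < i < u./2 -> 0 < i < u.
  by move=> /andP[-> iu]; apply: leq_trans iu (leq_half u).
have [bt|bf] := boolP b.
  have eu := bu bt; rewrite -bE //; split=> //; first exact: half_gt0.
  move=> i iu; apply/negP => /(small i (half_small i iu)) e.
  by move: iu; rewrite -e doubleK ltnn andbF.
have [/andP[/eqP p3 ou]|n3] := boolP ((p %% 4 == 3) && odd u); split.
- by rewrite muln_gt0 u_gt0.
- by rewrite /odd_cond (expn_mod4 _ p_odd) oddM /= orbT -dvd_u dvdn_mull.
- move=> i /andP[i0 iu]; apply/negP => ci.
  (* As u is odd, it divides i, so 0 < i < 2u leaves i = u; but p^u = 3 modulo 4. *)
  have ui : u %| i.
    by rewrite -(@Gauss_dvdr _ 2) ?coprimen2 // mul2n odd_cond_dvd.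
  have iE : i = u.
    case/dvdnP: ui i0 iu => [[|[|q]] ->]; rewrite ?mul0n ?mul1n // => _.
    by rewrite ltn_pmul2r // !ltnS ltn0.
  by move: (odd_cond_ndvd ci ui); rewrite (expn_mod4 _ p_odd) iE ou p3.
- exact: u_gt0.
- by apply: cu; move: n3; case: p4 => -> //=; [left|right].
- move=> i iu; apply/negP => ci; have e := small i iu ci.
  by move: bf; rewrite bE -e ?odd_double // doubleK ci.
Qed.

End OddDegree.

Section EvenDegree.
Local Open Scope nat_scope.
Variable m : nat.
Hypotheses (m_gt2 : 2 < m) (m_odd : coprime 2 m).

(** In characteristic 2, for a of order m, this expresses that a^(2^i) is a or 1/a = -1/a. *)
Definition two_cond (i : nat) : bool :=
  let r := 2 ^ i %% m in (r == 1) || (r == m.-1).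

Lemma delta_twoP : [/\ 0 < delta_two m, two_cond (delta_two m) &
  forall i, 0 < i < delta_two m -> ~~ two_cond i].
Proof.
have m1 : 1 < m by apply: ltnW.
rewrite /delta_two; set u := ordmod 2 m.
have u0 : 0 < u by [].
have dvd_u i : (u %| i) = (2 ^ i %% m == 1) by rewrite /u ordmod_dvd // (modn_small m1).
have small i : 0 < i < u -> two_cond i -> i.*2 = u /\ 2 ^ i %% m == m.-1.
  move=> /andP[i0 iu]; rewrite /two_cond -dvd_u => /orP[/(dvdn_leq i0)|im].
    by rewrite leqNgt iu.
  split=> //; apply: dvdn_double_small; first by rewrite i0.
  have : u %| i.*2.
    rewrite dvd_u -muln2 expnM -modnXm (eqP im).
    have -> : m.-1 ^ 2 = (m - 2) * m + 1 by move: m_gt2; nia.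
    by rewrite modnMDl modn_small.
  by [].
have [/andP[eu hu]|nb] := boolP (~~ odd u && _); split.
- by rewrite -double_gt0 even_halfK.
- by rewrite /two_cond hu orbT.
- move=> i /andP[i0 iu]; apply/negP => /(small i) [|e _].
    by rewrite i0 (leq_trans iu (leq_half u)).
  by move: iu; rewrite -e doubleK ltnn.
- exact: u0.
- by rewrite /two_cond -dvd_u dvdnn.
- move=> i iu; apply/negP => /(small i iu) [e im].
  by move: nb; rewrite -e odd_double doubleK im.
Qed.

End EvenDegree.

(** * Reduction of the fibotomic polynomial modulo p *)

Lemma Cyclotomic1 : 'Phi_1 = 'X - 1.
Proof. by have := prod_Cyclotomic (ltn0Sn 0); rewrite big_seq1 expr1. Qed.

Lemma Cyclotomic2 : 'Phi_2 = 'X + 1.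
Proof.
have := prod_Cyclotomic (ltn0Sn 1); rewrite big_cons big_seq1 Cyclotomic1.
have -> : 'X^2 - 1 = ('X - 1) * ('X + 1) :> {poly int} by ring.
by apply: mulfI; rewrite -polyC1 polyXsubC_eq0.
Qed.

Lemma eq_sub_inv (K : fieldType) (a x : K) : a != 0 -> x != 0 ->
  (x - x^-1 == a - a^-1) = (x == a) || (x * a == -1).
Proof.
move=> a0 x0; rewrite -subr_eq0 -(subr_eq0 x a) -[x * a == -1]subr_eq0 opprK -mulf_eq0.
have -> : x - x^-1 - (a - a^-1) = ((x - a) * (x * a + 1)) * (x * a)^-1.
  by field; rewrite a0 x0.
by rewrite [LHS]mulf_eq0 invr_eq0 !mulf_eq0 (negPf a0) (negPf x0) !orbF.
Qed.

Section ModP.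
Variables (p : nat) (K : closedFieldType) (phi : {rmorphism 'F_p -> K}).
Hypothesis pp : prime p.

Let pK : p \in [pchar K] := pcharK phi pp.

Lemma map_redp (P : {poly int}) : map_poly phi (redp p P) = map_poly intr P.
Proof.
by rewrite /redp -map_poly_comp; apply: eq_map_poly => z /=; rewrite rmorph_int.
Qed.

Lemma eq_poly_sub_inv (f g : {poly 'F_p}) :
  (forall a, a != 0 -> (map_poly phi f).[a - a^-1] = (map_poly phi g).[a - a^-1]) ->
  f = g.
Proof.
move=> fg; apply: (map_inj_poly (fmorph_inj phi) (rmorph0 _)).
apply: horner_neq0_inj => b _; have [a a0 ->] := sub_inv_surj b.
exact: fg.
Qed.

Section Psi.
Variables m k : nat.
Hypotheses (m_gt0 : (0 < m)%N) (pm : coprime p m) (n_gt1 : (1 < p ^ k * m)%N).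
Let n := (p ^ k * m)%N.
Let e := totient (p ^ k).
Let PK := map_poly phi (redp p (Psi n)).
Notation PhiK d := (map_poly (intr : int -> K) 'Phi_d).

Lemma Psi_spec : [/\ Psi n \is monic, size (Psi n) = (totient n).+1 &
  homog (totient n) (Psi n) = (-1) ^+ totient n *: ('Phi_n \Po (- 'X^2))].
Proof.
have n0 : (0 < n)%N by apply: ltnW.
have fP := Psi_fibotomic n0.
by have [-> ->] := fibotomic_hom n0 fP n_gt1; split=> //; case: fP.
Qed.

Lemma hom_redp_Psi :
  homog (totient n) PK = (-1) ^+ totient n *: (PhiK m ^+ e \Po (- 'X^2)).
Proof.
have [_ _ hP] := Psi_spec.
rewrite /PK map_redp -map_hom hP map_polyZ map_comp_poly rmorphN /= map_polyXn.
by rewrite rmorphXn /= rmorphN rmorph1 -(Cyclotomic_pchar k pK).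
Qed.

Lemma size_redp_Psi : size PK = (totient n).+1.
Proof.
have [Pm sP _] := Psi_spec.
by rewrite /PK map_redp size_map_poly_id0 ?(monicP Pm) ?rmorph1 ?oner_neq0.
Qed.

Lemma redp_Psi_sub_inv (a : K) : a != 0 ->
  a ^+ totient n * PK.[a - a^-1] =
  (-1) ^+ totient n * (PhiK m).[- a ^+ 2] ^+ e.
Proof.
move=> a0; rewrite -horner_hom ?size_redp_Psi // hom_redp_Psi.
by rewrite hornerZ horner_comp hornerN hornerXn horner_exp.
Qed.

(** Both factorizations of the reduced identity are compared at a, for a root b = a - 1/a: one side
    counts the occurrences of b, the other gives [e * sqr_mult K] because -a^2 is a simple root of
    Phi_m. *)
Lemma redp_Psi_roots : (2 < m)%N -> exists B : seq K,
  [/\ uniq B, (size B * sqr_mult K)%N = totient m,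
      {in B, forall b, b ^+ p \in B},
      {in B, forall b, exists a, [/\ a != 0, b = a - a^-1 & m.-primitive_root (- a ^+ 2)]} &
      PK = \prod_(b <- B) ('X - b%:P) ^+ (e * sqr_mult K)].
Proof.
move=> m_gt2; have [Pm _ _] := Psi_spec.
have PKm : PK \is monic by rewrite /PK map_redp monic_map.
have [rs rsP] := monic_prod_roots PKm.
have srs : size rs = totient n by have := size_redp_Psi; rewrite rsP size_prod_XsubC => -[].
have PhiCm : PhiK m \is monic by apply: monic_map; exact: Cyclotomic_monic.
have [ws wsP] := monic_prod_roots PhiCm.
have mK : m%:R != 0 :> K.
  by rewrite -(dvdn_pcharf pK) -prime_coprime.
have uws : uniq ws by rewrite -separable_prod_XsubC -wsP Cyclotomic_separable.
have ws1 w : count_mem w ws = m.-primitive_root w.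
  by rewrite count_uniq_mem // -root_prod_XsubC -wsP root_Cyclotomic.
have sws : size ws = totient m.
  have := size_Cyclotomic m.
  rewrite -(@size_map_poly_id0 _ _ (intr : int -> K)); last first.
    by rewrite (monicP (Cyclotomic_monic m)) rmorph1 oner_neq0.
  by rewrite wsP size_prod_XsubC => -[].
have nE : totient n = (totient m * e)%N by rewrite /n totient_coprime ?coprimeXl // mulnC.
have eqQ : \prod_(b <- rs) quad b = (\prod_(w <- ws) ('X^2 + w%:P)) ^+ e.
  have := hom_redp_Psi; rewrite rsP -srs hom_prod_XsubC srs => ->.
  rewrite wsP rmorphXn /= prod_comp_oppXsqr sws exprZn scalerA -exprM -nE.
  by rewrite -exprMn mulrNN mulr1 expr1n scale1r.
have inrs b : b \in rs -> exists a, [/\ a != 0, b = a - a^-1 & m.-primitive_root (- a ^+ 2)].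
  move=> brs; have [a a0 bE] := sub_inv_surj b; exists a; split=> //.
  rewrite -(root_Cyclotomic mK); have := redp_Psi_sub_inv a0.
  have /rootP -> : root PK (a - a^-1) by rewrite rsP root_prod_XsubC -bE.
  rewrite mulr0 => /esym/eqP; rewrite mulf_eq0 signr_eq0 expf_eq0 => /andP[_].
  by [].
have crs b : b \in rs -> count_mem b rs = (e * sqr_mult K)%N.
  (* If a^2 were -1, then 1 would be a primitive m-th root of unity with m > 2. *)
  move=> /inrs [a [a0 -> ap]]; have a2 : a ^+ 2 != -1.
    apply/eqP => a2; have := prim_order_dvd ap 1.
    by rewrite a2 opprK expr1n eqxx dvdn1 gtn_eqF // ltnW.
  rewrite -mup_prod_quad // eqQ mup_exp; last first.
    by rewrite monic_neq0 // monic_prod // => w _; apply: XsqrD_monic.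
  by rewrite mup_prod_XsqrD // ws1 ap mul1n.
have PKE : PK = \prod_(b <- undup rs) ('X - b%:P) ^+ (e * sqr_mult K).
  rewrite rsP -prodr_undup_exp_count.
  by apply: eq_big_seq => b; rewrite mem_undup => /crs ->.
have e0 : (0 < e)%N by rewrite totient_gt0 expn_gt0 prime_gt0.
exists (undup rs); split=> //; first exact: undup_uniq.
- have := size_redp_Psi; rewrite PKE.
  rewrite (@size_prod_monic _ _ _ _ (e * sqr_mult K)%N); last first.
    by move=> b _; rewrite monic_exp ?monicXsubC // size_exp_XsubC.
  move=> [] /eqP; rewrite nE mulnCA [X in _ == X]mulnC eqn_pmul2l // => /eqP //.
- move=> b; rewrite !mem_undup -!root_prod_XsubC -rsP.
  by move=> /(root_Frobenius pp 1); rewrite expn1.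
- by move=> b; rewrite mem_undup => /inrs.
Qed.

Lemma redp_Psi_factor (d : nat) : (2 < m)%N -> (0 < d)%N ->
  (forall a : K, a != 0 -> m.-primitive_root (- a ^+ 2) ->
     Frobenius_period p d (a - a^-1)) ->
  exists qs : seq {poly 'F_p},
    [/\ uniq qs, size qs = (totient m %/ (sqr_mult K * d))%N,
        all (fun q => q \is monic) qs,
        (forall q, q \in qs -> irreducible_poly q /\ size q = d.+1) &
        redp p (Psi n) = \prod_(q <- qs) q ^+ (sqr_mult K * e)].
Proof.
move=> m_gt2 d0 per; have [B [uB sB cB rB PB]] := redp_Psi_roots m_gt2.
have [|qs [uqs sqs mqs iqs qsE]] := Frobenius_closed_prod phi pp d0 uB cB.
  by move=> b /rB [a [a0 -> ap]]; apply: per.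
exists qs; split=> //.
  have s0 : (0 < sqr_mult K)%N by rewrite /sqr_mult; case: ifP.
  by rewrite -sB -sqs -mulnA [(d * _)%N]mulnC mulnK // muln_gt0 s0.
apply: (map_inj_poly (fmorph_inj phi) (rmorph0 _)).
rewrite rmorph_prod /= -/PK PB mulnC !prodrXl -qsE.
by rewrite -prodrXl; apply: eq_bigr => q _; rewrite rmorphXn.
Qed.

End Psi.

Lemma Frobenius_period_sub_inv (d : nat) (a : K) : a != 0 ->
  let c i := (a ^+ (p ^ i) == a) || (a ^+ (p ^ i) * a == -1) in
  c d -> (forall i, (0 < i < d)%N -> ~~ c i) -> Frobenius_period p d (a - a^-1).
Proof.
move=> a0 c.
have cE i : ((a - a^-1) ^+ (p ^ i) == a - a^-1) = c i.
  have -> : (a - a^-1) ^+ (p ^ i) = a ^+ (p ^ i) - (a ^+ (p ^ i))^-1.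
    elim: i => [|i IH]; first by rewrite expn0 !expr1.
    rewrite expnSr !exprM IH -!(pFrobenius_autE pK) rmorphB /= fmorphV //.
  by rewrite eq_sub_inv // expf_neq0.
by move=> cd ci; split=> [|i /ci]; [apply/eqP; rewrite cE | rewrite -cE => /eqP].
Qed.

Lemma delta_odd_period (m : nat) (a : K) : (2 < p)%N -> (2 < m)%N -> coprime p m ->
  a != 0 -> m.-primitive_root (- a ^+ 2) -> Frobenius_period p (delta_odd p m) (a - a^-1).
Proof.
move=> p_gt2 m_gt2 pm a0 ap.
have two0 : 2%:R != 0 :> K.
  by rewrite -(dvdn_pcharf pK) gtnNdvd.
have m1_neq1 : -1 != 1 :> K by rewrite eq_sym -subr_eq0 opprK -[1 + 1]/(2%:R).
have [i i2] : exists i : K, i ^+ 2 = -1.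
  have [i] := solve_monicpoly (fun j : nat => if j == 0%N then -1 else 0 : K) (ltn0Sn 1).
  by rewrite !big_ord_recl big_ord0 /= expr0 mulr1 mul0r !addr0; exists i.
have i0 : i != 0.
  by apply: contra_eq_neq i2 => ->; rewrite expr0n /= eq_sym oppr_eq0 oner_eq0.
have zP (j : K) : j ^+ 2 = -1 -> (a / j) ^+ 2 = - a ^+ 2.
  by move=> j2; rewrite expr_div_n j2 invrN invr1 mulrN1.
(* Of the two choices for [a / j], at least one has even order [2m]. *)
have [j [j2 zm]] : exists j : K, j ^+ 2 = -1 /\ (a / j) ^+ m = -1.
  have : ((a / i) ^+ m) ^+ 2 == 1.
    by rewrite -exprM mulnC exprM zP // (prim_expr_order ap).
  rewrite sqrf_eq1 => /orP[/eqP z1|/eqP zm]; last by exists i.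
  (* Replacing i by -i multiplies the m-th power by (-1)^m. Here m is odd, since otherwise
     (-a^2)^(m/2) = (a/i)^m = 1 contradicts primitivity. *)
  exists (- i); rewrite sqrrN; split=> //; rewrite invrN mulrN exprNn z1 mulr1.
  suff mo : odd m by rewrite -signr_odd mo expr1.
  apply: contraT => me; have mh : m = (m./2 * 2)%N by rewrite muln2 even_halfK.
  have := prim_order_dvd ap m./2; rewrite -(zP i i2) -exprM mulnC -mh z1 eqxx.
  by move/dvdn_leq; move: mh m_gt2; lia.
have j0 : j != 0.
  by apply: contra_eq_neq j2 => ->; rewrite expr0n /= eq_sym oppr_eq0 oner_eq0.
pose z := a / j; have aE : a = j * z by rewrite mulrCA mulfV ?mulr1.
have z0 : z != 0 by rewrite mulf_neq0 ?invr_eq0.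
have zprim : (2 * m).-primitive_root z.
  have zz : z ^+ (2 * m) = 1 by rewrite mulnC exprM zm sqrrN expr1n.
  have m20 : (0 < 2 * m)%N by rewrite muln_gt0 /= (ltnW (ltnW m_gt2)).
  have [d dz dvd] := prim_order_exists m20 zz.
  suff -> : (2 * m = d)%N by [].
  apply/eqP; rewrite eqn_dvd dvd andbT.
  (* The order d of z is a multiple q m, because z^2 = -a^2 has order m; and z^m = -1 forces q to be
     even. *)
  have : (m %| d)%N.
    by rewrite (prim_order_dvd ap) -(zP j j2) -exprM mulnC exprM (prim_expr_order dz) expr1n.
  move=> /dvdnP [q dE]; have := prim_expr_order dz.
  rewrite dE mulnC exprM zm -signr_odd; case: (odd q) (odd_double_half q) => /= e.
    by rewrite expr1 => /eqP; rewrite (negPf m1_neq1).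
  by rewrite -e add0n -mul2n mulnA [(m * 2)%N]mulnC dvdn_mulr.
have m2 : (1 < 2 * m)%N by lia.
have zeq P b : (b < 2 * m)%N -> (z ^+ P == z ^+ b) = (P %% (2 * m) == b)%N.
  by move=> bm; rewrite (eq_prim_root_expr zprim) (modn_small bm).
have condE s : (a ^+ (p ^ s) == a) || (a ^+ (p ^ s) * a == -1) = odd_cond p m s.
  rewrite /odd_cond; set P := (p ^ s)%N.
  have j4 : j ^+ 4 = 1 by rewrite (exprM j 2 2) j2 sqrrN expr1n.
  have jP : j ^+ P = j ^+ (P %% 4).
    by rewrite {1}(divn_eq P 4) exprD mulnC exprM j4 expr1n mul1r.
  have p4 : (P %% 4 = 1)%N \/ (P %% 4 = 3)%N.
    rewrite /P expn_mod4; first by case: ifP => _; [left|right].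
    by case: (even_prime pp) p_gt2 => [->|].
  rewrite aE exprMn jP; case: p4 => -> /=.
    (* Here j^P = j, so the two alternatives read z^P = z and z^(P+1) = 1. *)
    rewrite expr1 -(zeq _ 1%N) // -(zeq _ (2 * m).-1); last by lia.
    rewrite expr1 (inj_eq (mulfI j0)) mulrACA -expr2 j2 mulN1r (inj_eq oppr_inj).
    rewrite -[z ^+ P == z ^+ _](inj_eq (mulIf z0)) -!exprSr prednK; last by lia.
    by rewrite (prim_expr_order zprim).
  (* Here j^P = -j, so they read z^P = -z = z^(m+1) and z^(P+1) = -1 = z^m. *)
  rewrite -(zeq _ m.+1) -?(zeq _ m.-1); [|lia..].
  rewrite exprS j2 mulrN1 mulNr -mulrN (inj_eq (mulfI j0)).
  rewrite exprS zm mulrN1 eqr_oppLR; congr (_ || _).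
  rewrite mulrACA -expr2 j2 mulN1r mulNr opprK -[RHS](inj_eq (mulIf z0)).
  rewrite -!exprSr prednK ?zm //.
  by lia.
have [d0 dc dmin] := delta_oddP pp p_gt2 m_gt2 pm.
apply: Frobenius_period_sub_inv => // [|s /dmin]; by rewrite condE.
Qed.

(** In characteristic 2 signs disappear and 1 is its only square root, so [a] itself is a primitive
    m-th root of unity. *)
Lemma delta_two_period (m : nat) (a : K) : p = 2%N -> (2 < m)%N -> coprime p m ->
  a != 0 -> m.-primitive_root (- a ^+ 2) -> Frobenius_period p (delta_two m) (a - a^-1).
Proof.
move=> p2 m_gt2 pm a0 ap.
have two0 : 2%:R = 0 :> K by have := pcharf0 pK; rewrite p2.
have opp (x : K) : - x = x by rewrite -[RHS]subr0 -[0](mulr0 x) -two0; ring.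
have am : a ^+ m = 1.
  have := prim_expr_order ap; rewrite opp -exprM mulnC exprM => /eqP.
  by rewrite sqrf_eq1 opp orbb => /eqP.
have aprim : m.-primitive_root a.
  have [d da dm] := prim_order_exists (ltnW (ltnW m_gt2)) am.
  suff -> : m = d by [].
  apply/eqP; rewrite eqn_dvd dm andbT (prim_order_dvd ap) opp -exprM mulnC exprM.
  by rewrite (prim_expr_order da) expr1n.
have condE s : (a ^+ (p ^ s) == a) || (a ^+ (p ^ s) * a == -1) = two_cond m s.
  rewrite /two_cond p2 opp -{2}[a]expr1 (eq_prim_root_expr aprim) (modn_small (ltnW m_gt2)).
  rewrite -am -{2}(prednK (ltnW (ltnW m_gt2))) exprSr (inj_eq (mulIf a0)).
  by rewrite (eq_prim_root_expr aprim) (@modn_small m.-1) // ltn_predL ltnW // ltnW.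
rewrite p2 in pm; have [d0 dc dmin] := delta_twoP m_gt2 pm.
apply: Frobenius_period_sub_inv => // [|s /dmin]; by rewrite condE.
Qed.

(** Phi_1(-a^2) = -(a^2 + 1), and (a^2 + 1)^2 = a^2 ((a - 1/a)^2 + 4). Halving the exponent is exact
    because phi(p^k) is even unless p^k = 2. *)
Lemma redp_Psi_pow (k : nat) : (1 < p ^ k)%N ->
  if ((p == 2) && (k == 1))%N then redp p (Psi (p ^ k)) = 'X
  else redp p (Psi (p ^ k)) = ('X ^+ 2 + 4%:R%:P) ^+ (totient (p ^ k) %/ 2).
Proof.
move=> n1; have n1' : (1 < p ^ k * 1)%N by rewrite muln1.
have k0 : (0 < k)%N by move: n1; clear; case: k.
have val (a : K) : a != 0 -> a ^+ totient (p ^ k) *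
    (map_poly phi (redp p (Psi (p ^ k)))).[a - a^-1] = (a ^+ 2 + 1) ^+ totient (p ^ k).
  move=> a0; have := redp_Psi_sub_inv (ltn0Sn 0) (coprimen1 p) n1' a0; rewrite muln1 => ->.
  rewrite Cyclotomic1 rmorphB /= rmorph1 map_polyX !hornerE -exprMn; congr (_ ^+ _); ring.
case: ifP => [/andP[/eqP p2 /eqP k1]|pk]; apply: eq_poly_sub_inv => a a0.
  have two0 : 2%:R = 0 :> K by have := pcharf0 pK; rewrite p2.
  have t1 : totient (p ^ k) = 1%N by rewrite p2 k1.
  apply: (mulfI a0); have := val a a0; rewrite t1 !expr1 => ->.
  have n1K : -1 = 1 :> K by apply/eqP; rewrite -subr_eq0 -opprD oppr_eq0 -two0.
  by rewrite map_polyX hornerX mulrBr mulfV // -expr2 n1K.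
have e2 : (totient (p ^ k) = 2 * (totient (p ^ k) %/ 2))%N.
  rewrite mulnC divnK // totient_pfactor // dvdn2 oddM oddX.
  case: (even_prime pp) => [p2|po]; last by rewrite -subn1 oddB ?prime_gt0 // po.
  by move: k0 pk; rewrite p2 /=; clear; case: k => [|[|k]].
apply: (mulfI (expf_neq0 (totient (p ^ k)) a0)); rewrite val //.
rewrite rmorphXn rmorphD /= map_polyXn map_polyC /= horner_exp !hornerE rmorph_nat.
rewrite [in X in _ ^+ X]e2 [in X in _ = _ ^+ X * _]e2 !exprM -exprMn; congr (_ ^+ _).
by field.
Qed.

(** Phi_2(-a^2) = 1 - a^2 = -a (a - 1/a), which is linear in a - 1/a. *)
Lemma redp_Psi_double_pow (k : nat) : coprime p 2 ->
  redp p (Psi (p ^ k * 2)) = 'X ^+ totient (p ^ k).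
Proof.
move=> pm; have n1 : (1 < p ^ k * 2)%N.
  by rewrite muln2 -addnn -addn1 leq_add // expn_gt0 prime_gt0.
apply: eq_poly_sub_inv => a a0.
have := redp_Psi_sub_inv (ltn0Sn 1) pm n1 a0.
rewrite totient_coprime ?coprimeXl // muln1 Cyclotomic2 rmorphD /= rmorph1 map_polyX !hornerE.
rewrite -exprMn => val; apply: (mulfI (expf_neq0 (totient (p ^ k)) a0)); rewrite val.
by rewrite map_polyXn hornerXn -exprMn; congr (_ ^+ _); field.
Qed.

End ModP.

(** * The four cases, read off over an algebraic closure of F_p *)

Theorem mainTheorem17 (p m k : nat) :
  prime p -> (0 < m)%N -> coprime p m -> (2 <= p ^ k * m)%N ->
  [/\
   (* (i) *)
   (m = 1%N ->
      if ((p == 2) && (k == 1))%N then redp p (Psi (p ^ k * m)) = 'X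
      else redp p (Psi (p ^ k * m)) = ('X ^+ 2 + 4%:R%:P) ^+ (totient (p ^ k) %/ 2)),
   (* (ii) *)
   (m = 2%N -> redp p (Psi (p ^ k * m)) = 'X ^+ totient (p ^ k)),
   (* (iii) *)
   ((3 <= m)%N -> (2 < p)%N ->
      exists qs : seq {poly 'F_p},
        [/\ uniq qs, size qs = (totient m %/ delta_odd p m)%N,
            all (fun q => q \is monic) qs,
            (forall q, q \in qs -> irreducible_poly q /\ size q = (delta_odd p m).+1) &
            redp p (Psi (p ^ k * m)) = \prod_(q <- qs) q ^+ totient (p ^ k)])
   &
   (* (iv) *)
   ((3 <= m)%N -> p = 2%N ->
      exists qs : seq {poly 'F_p},
        [/\ uniq qs, size qs = (totient m %/ (2 * delta_two m))%N,
            all (fun q => q \is monic) qs,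
            (forall q, q \in qs -> irreducible_poly q /\ size q = (delta_two m).+1) &
            redp p (Psi (p ^ k * m)) = \prod_(q <- qs) q ^+ (2 * totient (p ^ k))%N])].
Proof.
move=> pp m0 pm n1; have [K [phi _]] := countable_algebraic_closure 'F_p.
have pK := pcharK phi pp.
split=> [m1|m2|m_gt2 p_gt2|m_gt2 p2].
- by rewrite m1 muln1; apply: (redp_Psi_pow phi pp); rewrite m1 muln1 in n1.
- by rewrite m2 in pm *; apply: (redp_Psi_double_pow phi pp).
- have s1 : sqr_mult K = 1%N.
    by rewrite /sqr_mult -(dvdn_pcharf pK) gtnNdvd.
  have [d0 _ _] := delta_oddP pp p_gt2 m_gt2 pm.
  have := redp_Psi_factor phi pp m0 pm n1 m_gt2 d0; rewrite s1 !mul1n => h; apply: h => a.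
  exact: delta_odd_period.
- have s2 : sqr_mult K = 2%N.
    by rewrite /sqr_mult -(dvdn_pcharf pK) p2.
  have m_odd : coprime 2 m by rewrite -p2.
  have [d0 _ _] := delta_twoP m_gt2 m_odd.
  have := redp_Psi_factor phi pp m0 pm n1 m_gt2 d0; rewrite s2 => h; apply: h => a.
  exact: delta_two_period.
Qed.
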